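(* Let $n\ge 2$ and let $X=(X_{ij})$ be an $n\times n$ adjacency matrix (binary, symmetric, zero diagonal), with $X_{i+}=\sum_{k=1}^n X_{ik}$ and $X_{++}=\sum_{i=1}^n X_{i+}$, and let $\varepsilon_0$ be a real number such that $$1\le X_{i+}^2\le \varepsilon_0\,X_{++}\qquad\text{for all } i=1,\dots,n.$$ Let $\varepsilon=\{\varepsilon_{ij}:i\ne j\}$ be a family of smooth functions satisfying the sub-exponential assumption with constant $C_0$ (see context), and let the model $\mathcal{M}_\varepsilon$ with parameter vector $\alpha\in\mathbb{R}^n$ specify the edge probabilities $p_{ij}=p_{ij}(\alpha)$ by $$\log p_{ij}(\alpha)=\alpha_i+\alpha_j+\varepsilon_{ij}(\alpha_i,\alpha_j).$$ Let $\tilde\alpha\in\mathbb{R}^n$ be given by $\tilde\alpha_i=\log X_{i+}-\log\sqrt{X_{++}}$. Define $\bar\varepsilon_0=\{15(C_0+1)\}^{-2}$ and $C=10(C_0+1)$. If $\varepsilon_0\le\bar\varepsilon_0$, then there exists a solution $\hat\alpha\in\mathbb{R}^n$ to the likelihood equation $\nabla\ell(\hat\alpha)=0$ such that $$\|\hat\alpha-\tilde\alpha\|_\infty\le C\,\varepsilon_0 .$$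
   Context: The matrix $X$ is deterministic here; no assumption is made on how it was generated. For each pair $i\neq j$, $\varepsilon_{ij}:\mathbb{R}^2\to\mathbb{R}$ is smooth, with $\varepsilon_{ij}(x,y)=\varepsilon_{ji}(y,x)$; it is evaluated at $(\alpha_i,\alpha_j)$. Sub-exponential assumption with constant $C_0\ge 0$: for all pairs $i\ne j$ and all indices $k,l,m$, the functions $\varepsilon_{ij}$, $\partial\varepsilon_{ij}/\partial\alpha_k$, $\partial^2\varepsilon_{ij}/(\partial\alpha_k\partial\alpha_l)$ and $\partial^3\varepsilon_{ij}/(\partial\alpha_k\partial\alpha_l\partial\alpha_m)$ are bounded in absolute value by $C_0\exp(\alpha_i+\alpha_j)$. Under $\mathcal{M}_\varepsilon$ the entries of $X$ above the diagonal are modelled as independent Bernoulli variables with $\Pr(X_{ij}=1)=p_{ij}(\alpha)$. The log-likelihood, defined where all $p_{ij}(\alpha)<1$, is $$\ell(\alpha)=\sum_{i<j}\bigl[X_{ij}\log p_{ij}(\alpha)+(1-X_{ij})\log(1-p_{ij}(\alpha))\bigr],$$ and the likelihood equation is $\nabla\ell(\alpha)=0$, with gradient taken in $\alpha$. $\|\cdot\|_\infty$ is the maximum norm on $\mathbb{R}^n$. *)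

(* Defs.v *)
From mathcomp Require Import all_boot all_order all_algebra.
From mathcomp Require Import all_classical all_reals all_analysis.

Set Implicit Arguments.
Unset Strict Implicit.
Unset Printing Implicit Defensive.

Import Order.TTheory GRing.Theory Num.Theory.
Import numFieldNormedType.Exports.

Local Open Scope ring_scope.

Section Calculus.
Context {R : realType} {n : nat}.
Implicit Type f : 'rV[R]_n -> R.

Definition partial (k : 'I_n) f : 'rV[R]_n -> R :=
  fun a => 'D_(delta_mx 0 k) f a.

Definition gradient f (a : 'rV[R]_n) : 'rV[R]_n := \row_k partial k f a.

(* Infinite differentiability: the function and all of its iterated partial
   derivatives are Frechet differentiable (hence continuous) everywhere. *)
Definition smooth f : Prop :=
  forall (s : seq 'I_n) (a : 'rV[R]_n), differentiable (foldr partial f s) a.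

End Calculus.

Definition smooth2 {R : realType} (h : R -> R -> R) : Prop :=
  smooth (fun v : 'rV[R]_2 => h (v 0 0) (v 0 1)).

Section Model.
Context {R : realType} {n : nat}.

Definition adjacency (X : 'M[R]_n) : Prop :=
  [/\ forall i j, X i j = 0 \/ X i j = 1,
      forall i j, X i j = X j i
    & forall i, X i i = 0].

Definition degree (X : 'M[R]_n) (i : 'I_n) : R := \sum_k X i k.

Definition total_degree (X : 'M[R]_n) : R := \sum_i degree X i.

(* The values of a family [eps] at i = j are never used. *)
Implicit Type eps : 'I_n -> 'I_n -> R -> R -> R.
Implicit Type a : 'rV[R]_n.

Definition eps_at eps i j : 'rV[R]_n -> R := fun a => eps i j (a 0 i) (a 0 j).

Definition sub_exponential (C0 : R) eps : Prop :=
  forall i j, i != j -> forall k l m a,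
  let B := C0 * expR (a 0 i + a 0 j) in
  [/\ `|eps_at eps i j a| <= B,
      `|partial k (eps_at eps i j) a| <= B,
      `|partial k (partial l (eps_at eps i j)) a| <= B
    & `|partial k (partial l (partial m (eps_at eps i j))) a| <= B].

Definition edge_prob eps i j a : R :=
  expR (a 0 i + a 0 j + eps_at eps i j a).

Definition loglik_dom eps a : Prop :=
  forall i j, i != j -> edge_prob eps i j a < 1.

(* Meaningful on [loglik_dom eps] only: [ln] is 0 at nonpositive arguments. *)
Definition loglik (X : 'M[R]_n) eps a : R :=
  \sum_(i < n) \sum_(j < n | (i < j)%N)
    (X i j * ln (edge_prob eps i j a)
     + (1 - X i j) * ln (1 - edge_prob eps i j a)).

(* Differentiability is required because ['D_v f a] is a total operator. *)
Definition likelihood_eq (X : 'M[R]_n) eps a : Prop :=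
  [/\ loglik_dom eps a, differentiable (loglik X eps) a
    & gradient (loglik X eps) a = 0].

Definition alpha_tilde (X : 'M[R]_n) : 'rV[R]_n :=
  \row_i (ln (degree X i) - ln (Num.sqrt (total_degree X))).

End Model.

(* Main.v *)
From HB Require Import structures.
Require Import Defs.
From mathcomp Require Import all_boot all_order all_algebra.
From mathcomp Require Import all_classical all_reals all_analysis.
From mathcomp Require Import zify ring lra.
Import Order.TTheory GRing.Theory Num.Theory.
Import numFieldNormedType.Exports.
Local Open Scope ring_scope.

(** The gradient of the log-likelihood has coordinates

      f_k(a) = sum_{j != k} (X_kj - p_kj) / (1 - p_kj) * (1 + D_kj),

    where D_kj is the derivative of eps_kj with respect to a_k.  Write d_i for
    the degrees, S for their sum, z for the explicit approximation
    [alpha_tilde X] and P_kj = exp (z_k + z_j) = d_k d_j / S.  The degree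
    hypothesis gives P_kj <= eps0, so near z every p_kj and every eps_kj is
    tiny and p_kj is close to P_kj; hence the Jacobian of f near z is close to
    minus the matrix diag(d) + d d^T / S.  This matrix is explicitly inverted:

      (diag(d) + d d^T / S)^-1 = diag(d)^-1 - 1 1^T / (2 S).

    The theorem is therefore obtained from a Newton iteration that uses this
    inverse at every point, [newton_map]:

      T(a)_k = a_k + f_k(a) / d_k - (sum_l f_l(a)) / (2 S).

    A fixed point of T is a zero of f ([newton_map_fixed]).  In the maximum
    norm the correction term costs at most a factor 3/2 ([newton_step_le]), for
    each f_k is controlled relative to d_k.  With K = C0 + 1 the hypothesis on
    eps0 gives K eps0 <= 1/225, and on the ball of radius r = 10 K eps0 <= 2/45
    around z
    - T is a contraction with ratio 45/100 ([newton_map_contraction]), since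
      each summand of f differs from its linear model by a small fraction of
      P_kj and X_kj ([pair_score_contraction]), both of which sum to at most d_k
      over j;
    - T moves z by at most 4.65 K eps0 ([newton_map_base]), which is less than
      (1 - 45/100) r.
    The contraction principle then yields a zero of f within r of z
    ([fixed_point_in_ball]), and [likelihood_gradient] identifies f with the
    gradient of the log-likelihood, all p_kj being smaller than 1 on the ball.

    The increments of eps_kj and D_kj on the ball are controlled by the
    sub-exponential bounds of the next order ([eps_lipschitz]). *)

(** * Fixed points and mean values *)

(* Completeness and the norm of a matrix space are declared separately; this
   joins them, so that row vectors form a complete normed module. *)
HB.instance Definition _ (R : realType) m n := Complete.on 'M[R]_(m, n).

(** The bound on the displacement of the centre, added to the contraction,
    makes the ball stable under [T]. *)
Lemma fixed_point_in_ball {R : realType} {V : completeNormedModType R}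
    (T : V -> V) (z : V) (r q : R) :
    0 <= q < 1 -> 0 <= r ->
    (forall x y, `|x - z| <= r -> `|y - z| <= r ->
       `|T x - T y| <= q * `|x - y|) ->
    `|T z - z| <= (1 - q) * r ->
  exists2 p, `|p - z| <= r & T p = p.
Proof.
move=> /andP[q0 q1] r0 Tlip Tz.
pose U : set V := [set x | `|x - z| <= r]%classic.
have Uz : U z by rewrite /U /= subrr normr0.
have TU : set_fun U U T.
  move=> x Ux; rewrite /U /= -(subrKA (T z)).
  apply: le_trans (ler_normD _ _) _.
  have := Tlip _ _ Ux Uz; have := ler_wpM2l q0 Ux; lra.
pose F : {fun U >-> U} := HB.pack T (isFun.Build _ _ U U T TU).
have clU : closed U.
  have -> : U = ((fun x : V => `|x - z|) @^-1` [set t | t <= r])%classic by [].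
  apply: closed_comp; last exact: closed_le.
  by move=> x _; apply: cvg_norm; apply: cvgB; [exact: cvg_id|exact: cvg_cst].
have FC : is_contraction F.
  by exists (NngNum q0); split => //= -[x y] [/= Ux Uy]; exact: Tlip.
have [|p Up pE] := banach_fixed_point FC clU; first by exists z.
by exists p.
Qed.

Lemma is_derive_line {R : realType} {V : normedModType R} (F : V -> R)
    (a v : V) (t : R) :
  derivable F (t *: v + a) v ->
  is_derive t 1 (fun s => F (s *: v + a)) ('D_v F (t *: v + a)).
Proof.
have E : (fun h => h^-1 *: (F ((h *: 1 + t) *: v + a) - F (t *: v + a))) =
         (fun h => h^-1 *: (F (h *: v + (t *: v + a)) - F (t *: v + a))).
  by apply/funext => h; rewrite [h *: 1]mulr1 scalerDl -addrA.
move=> dF; split; first by rewrite /derivable /= E.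
by rewrite /derive /= E.
Qed.

(** The derivative is only bounded on the segment from [a] to [b]: the
    exponential bounds of the model degrade with the size of the parameter. *)
Lemma line_mean_value {R : realType} {V : normedModType R} (F : V -> R)
    (a b : V) (B : R) :
    (forall c, derivable F c (b - a)) ->
    (forall s : R, 0 <= s <= 1 -> `|'D_(b - a) F (s *: (b - a) + a)| <= B) ->
  `|F b - F a| <= B.
Proof.
move=> dF DB.
have dline (s : R) : is_derive s (1 : R) (fun s : R => F (s *: (b - a) + a))
    ('D_(b - a) F (s *: (b - a) + a)).
  exact: is_derive_line.
have cont A : {within A, continuous (fun s : R => F (s *: (b - a) + a))}%classic.
  apply: continuous_subspaceT => s; apply: differentiable_continuous.
  by apply/derivable1_diffP; apply: ex_derive.
have [c] := MVT_segment (ler01 : 0 <= 1 :> R) (fun s _ => dline s) (cont _).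
rewrite in_itv /= scale1r subrK scale0r add0r subr0 mulr1 => c01 ->.
exact: DB.
Qed.

(** * Functions of two coordinates *)

(** The functions [eps_at eps i j] and their derivatives depend on the
    coordinates [i] and [j] only: they are functions on the plane composed with
    the linear map [colsub (pick2 i j)]. *)
Definition pick2 {n} (i j : 'I_n) : 'I_2 -> 'I_n :=
  fun l => if l == 0 then i else j.

Lemma ler_coord_norm {R : realType} {n} (x : 'rV[R]_n) k : `|x 0 k| <= `|x|.
Proof.
rewrite [leRHS]/Num.norm /= mx_normrE.
by apply/bigmax_geP; right => /=; exists (0, k).
Qed.

Lemma norm_le_coord {R : realType} {n} (x : 'rV[R]_n) (B : R) :
  0 <= B -> (forall k, `|x 0 k| <= B) -> `|x| <= B.
Proof.
move=> B0 xB; rewrite [leLHS]/Num.norm /= mx_normrE.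
by apply/bigmax_leP; split => // -[u k] _ /=; rewrite ord1.
Qed.

Lemma differentiable_colsub {R : realType} {n p} (f : 'I_p -> 'I_n)
    (a : 'rV[R]_n) : differentiable (colsub f : 'rV[R]_n -> 'rV[R]_p) a.
Proof.
apply: linear_differentiable => x.
have Fx : Filter (nbhs x) by exact: nbhs_filter.
apply/(@cvgrPdist_le _ _ _ _ Fx) => /= e e0.
apply/nbhs_ballP; exists e => //= y; rewrite -ball_normE => /ltW xy.
rewrite -raddfB; apply: norm_le_coord => [|k]; first exact: ltW.
by rewrite mxE (le_trans (ler_coord_norm _ _)).
Qed.

(** A line is sent to a line, so that both directional derivatives are limits of
    the same difference quotients. *)
Lemma derive_comp_colsub {R : realType} {n p} (f : 'I_p -> 'I_n)
    (H : 'rV[R]_p -> R) (a v : 'rV[R]_n) :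
  'D_v (H \o colsub f) a = 'D_(colsub f v) H (colsub f a).
Proof.
have E : (fun h : R => h^-1 *: (H (colsub f (h *: v + a)) - H (colsub f a))) =
    (fun h => h^-1 *: (H (h *: colsub f v + colsub f a) - H (colsub f a))).
  by apply/funext => h; rewrite linearP.
by rewrite /derive /= E.
Qed.

Lemma derive_pair {R : realType} {n} (i j : 'I_n) (H : 'rV[R]_2 -> R)
    (F := H \o colsub (pick2 i j)) (a v : 'rV[R]_n) :
    i != j -> (forall w, differentiable H w) ->
  'D_v F a = v 0 i * partial i F a + v 0 j * partial j F a.
Proof.
move=> ij dH; rewrite /partial !derive_comp_colsub !deriveE//.
have {1}-> : colsub (pick2 i j) v = v 0 i *: colsub (pick2 i j) (delta_mx 0 i) +
    v 0 j *: colsub (pick2 i j) (delta_mx 0 j).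
  apply/rowP => l; rewrite !mxE /pick2; case: (l == 0).
    by rewrite !eqxx (negbTE ij) /=; ring.
  by rewrite !eqxx eq_sym (negbTE ij) /=; ring.
by rewrite linearD !linearZ.
Qed.

Lemma pair_lipschitz {R : realType} {n} (i j : 'I_n) (H : 'rV[R]_2 -> R)
    (F := H \o colsub (pick2 i j)) (M B d : R) (a b : 'rV[R]_n) :
    i != j -> (forall w, differentiable H w) ->
    (forall c : 'rV[R]_n, c 0 i + c 0 j <= M ->
       `|partial i F c| <= B /\ `|partial j F c| <= B) ->
    a 0 i + a 0 j <= M -> b 0 i + b 0 j <= M ->
    `|a 0 i - b 0 i| <= d -> `|a 0 j - b 0 j| <= d ->
  `|F a - F b| <= 2 * B * d.
Proof.
move=> ij dH DB aM bM di dj.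
have dF c : differentiable F c.
  by apply: differentiable_comp; [exact: differentiable_colsub|exact: dH].
apply: line_mean_value => [c|s /andP[s0 s1]]; first exact: diff_derivable.
set c := _ + b; rewrite derive_pair//.
have [|Di Dj] := DB c.
  rewrite !mxE; nra.
have := ler_normD ((a - b) 0 i * partial i F c) ((a - b) 0 j * partial j F c).
rewrite !normrM => /le_trans; apply.
have -> : 2 * B * d = d * B + d * B by ring.
by rewrite lerD// ler_pM// !mxE.
Qed.

Lemma eps_atE {R : realType} {n} (eps : 'I_n -> 'I_n -> R -> R -> R) i j :
  eps_at eps i j =
  (fun w : 'rV[R]_2 => eps i j (w 0 0) (w 0 1)) \o colsub (pick2 i j).
Proof. by apply/funext => a; rewrite /eps_at /= !mxE. Qed.

(** A first derivative is again a function of two coordinates, so that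
    [pair_lipschitz] applies to it as it does to the function itself. *)
Lemma partial_eps_atE {R : realType} {n} (eps : 'I_n -> 'I_n -> R -> R -> R)
    i j : i != j ->
  partial i (eps_at eps i j) =
  partial 0 (fun w : 'rV[R]_2 => eps i j (w 0 0) (w 0 1)) \o
    colsub (pick2 i j).
Proof.
move=> ij; apply/funext => a; rewrite eps_atE /partial derive_comp_colsub /=.
congr ('D_ _ _ _); apply/rowP => l; rewrite !mxE /pick2 eqxx /=.
by case: (l == 0); rewrite ?eqxx// eq_sym (negbTE ij).
Qed.

(** The sub-exponential bounds of one order control the increments of the
    derivatives of the order below.  The half-space [c_i + c_j <= M] is convex,
    hence contains the segment from [a] to [b], and there the bound
    [C0 * exp (c_i + c_j)] is at most [C0 * exp M]. *)
Lemma eps_lipschitz {R : realType} {n} (eps : 'I_n -> 'I_n -> R -> R -> R)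
    (C0 : R) i j (M d : R) (a b : 'rV[R]_n) :
    0 <= C0 -> i != j -> smooth2 (eps i j) -> sub_exponential C0 eps ->
    a 0 i + a 0 j <= M -> b 0 i + b 0 j <= M ->
    `|a 0 i - b 0 i| <= d -> `|a 0 j - b 0 j| <= d ->
  `|eps_at eps i j a - eps_at eps i j b| <= 2 * (C0 * expR M) * d /\
  `|partial i (eps_at eps i j) a - partial i (eps_at eps i j) b|
     <= 2 * (C0 * expR M) * d.
Proof.
move=> C00 ij seps subeps aM bM di dj.
have CM (c : 'rV[R]_n) : c 0 i + c 0 j <= M ->
    C0 * expR (c 0 i + c 0 j) <= C0 * expR M.
  by move=> cM; rewrite ler_wpM2l// ler_expR.
split.
  rewrite eps_atE; pose h (w : 'rV[R]_2) := eps i j (w 0 0) (w 0 1).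
  apply: (@pair_lipschitz _ _ i j h M _ d a b ij (seps [::])) => // c cM.
  rewrite -/h -eps_atE.
  have [_ Di _ _] := subeps i j ij i i i c.
  have [_ Dj _ _] := subeps i j ij j i i c.
  by split; [exact: le_trans Di (CM c cM)|exact: le_trans Dj (CM c cM)].
rewrite partial_eps_atE//; set h := partial 0 _.
apply: (@pair_lipschitz _ _ i j h M _ d a b ij (seps [:: 0])) => // c cM.
rewrite -partial_eps_atE//.
have [_ _ Di _] := subeps i j ij i i i c.
have [_ _ Dj _] := subeps i j ij j i i c.
by split; [exact: le_trans Di (CM c cM)|exact: le_trans Dj (CM c cM)].
Qed.

Lemma differentiable_eps_at {R : realType} {n}
    (eps : 'I_n -> 'I_n -> R -> R -> R) i j (a : 'rV[R]_n) :
  smooth2 (eps i j) -> differentiable (eps_at eps i j) a.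
Proof.
move=> seps; rewrite eps_atE; apply: differentiable_comp.
  exact: differentiable_colsub.
exact: (seps [::]).
Qed.

Lemma partial_eps_at_eq0 {R : realType} {n}
    (eps : 'I_n -> 'I_n -> R -> R -> R) i j k (a : 'rV[R]_n) :
  i != k -> j != k -> partial k (eps_at eps i j) a = 0.
Proof.
move=> ik jk; rewrite eps_atE /partial derive_comp_colsub.
suff -> : colsub (pick2 i j) (delta_mx 0 k) = 0 :> 'rV[R]_2 by rewrite derive0.
apply/rowP => l; rewrite !mxE /pick2 eqxx /=.
by case: (l == 0); rewrite (negbTE ik, negbTE jk).
Qed.

(** * The likelihood equation *)

(** Each unordered pair contributes once to the log-likelihood; the pairs
    containing [k] are those on which the [k]-th derivative does not vanish. *)
Lemma sum_upper_pairs {R : realType} {n} (t : 'I_n -> 'I_n -> R) (k : 'I_n) :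
    (forall i j, i != j -> t i j = t j i) ->
    (forall i j, i != j -> i != k -> j != k -> t i j = 0) ->
  \sum_(i < n) \sum_(j < n | (i < j)%N) t i j = \sum_(j | j != k) t k j.
Proof.
move=> tsym t0; rewrite (bigD1 k)//=.
rewrite [X in _ + X](_ : _ = \sum_(i < n | (i < k)%N) t k i).
  rewrite [RHS](bigID (fun j : 'I_n => (k < j)%N)) /=; congr (_ + _).
    by apply: eq_bigl => j; rewrite -val_eqE /=; lia.
  by apply: eq_bigl => j; rewrite -val_eqE /=; lia.
rewrite [RHS]big_mkcond [LHS]big_mkcond /=; apply: eq_bigr => i _.
have [->|ik] := eqVneq i k; first by rewrite ltnn.
rewrite /= big_mkcond (bigD1 k)//= big1 => [|j jk]; last first.
  by case: ifP => // ij; rewrite t0// -val_eqE /=; lia.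
by rewrite addr0; case: ifP => // _; exact: tsym.
Qed.

(** Derivative of the log-likelihood of one observation [x] of a Bernoulli
    variable of mean [p], along a coordinate in which [log p] has slope
    [1 + D]. *)
Definition bernoulli_score {R : realType} (x p D : R) : R :=
  (x - p) / (1 - p) * (1 + D).

Definition log_prob {R : realType} {n} (eps : 'I_n -> 'I_n -> R -> R -> R) i j
  : 'rV[R]_n -> R := fun a => a 0 i + a 0 j + eps_at eps i j a.

(** Log-likelihood of one observation as a function of the log-probability. *)
Definition pair_loglik {R : realType} (x u : R) : R :=
  x * u + (1 - x) * ln (1 - expR u).

Lemma is_derive_pair_loglik {R : realType} (x u : R) : expR u < 1 ->
  is_derive u (1 : R) (pair_loglik x) (bernoulli_score x (expR u) 0).
Proof.
move=> u1; have u0 : 0 < 1 - expR u by rewrite subr_gt0.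
have dln : is_derive (1 - expR u) (1 : R) (@ln R) (1 - expR u)^-1.
  exact: is_derive1_ln.
have din : is_derive u (1 : R) (fun v : R => 1 - expR v) (- expR u).
  have -> : (fun v : R => 1 - expR v) = cst 1 - @expR R by [].
  rewrite -[- expR u]sub0r; exact: is_deriveB.
have dcomp := @is_derive1_comp _ (@ln R) (fun v : R => 1 - expR v) u _ _ dln din.
have -> : pair_loglik x = x \*: (@id R) + (1 - x) \*: (@ln R \o (fun v : R => 1 - expR v)).
  by [].
apply: is_derive_eq.
by rewrite /bernoulli_score /GRing.scale /=; field; rewrite gt_eqF.
Qed.

Lemma differentiable_log_prob {R : realType} {n}
    (eps : 'I_n -> 'I_n -> R -> R -> R) i j (a : 'rV[R]_n) :
  smooth2 (eps i j) -> differentiable (log_prob eps i j) a.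
Proof.
move=> seps.
have -> : log_prob eps i j =
  (fun a : 'rV[R]_n => a 0 i) + (fun a : 'rV[R]_n => a 0 j) + eps_at eps i j by [].
apply: differentiableD; last exact: differentiable_eps_at.
by apply: differentiableD; exact: differentiable_coord.
Qed.

Lemma partial_log_prob {R : realType} {n}
    (eps : 'I_n -> 'I_n -> R -> R -> R) i j k (a : 'rV[R]_n) :
    smooth2 (eps i j) ->
  partial k (log_prob eps i j) a =
    (i == k)%:R + (j == k)%:R + partial k (eps_at eps i j) a.
Proof.
move=> seps; rewrite /partial.
have dcoord (l : 'I_n) : 'D_(delta_mx 0 k) (fun b : 'rV[R]_n => b 0 l) a = (l == k)%:R.
  apply/lim_near_cst => //=; near=> h.
  have h0 : h != 0 by near: h; exact: nbhs_dnbhs_neq.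
  by rewrite !mxE eqxx /= addrK scalerA mulVf// scale1r.
have -> : log_prob eps i j =
  (fun a : 'rV[R]_n => a 0 i) + (fun a : 'rV[R]_n => a 0 j) + eps_at eps i j by [].
rewrite deriveD; last 2 first.
- by apply: derivableD; apply: diff_derivable; exact: differentiable_coord.
- by apply: diff_derivable; exact: differentiable_eps_at.
by rewrite deriveD ?dcoord//; apply: diff_derivable; exact: differentiable_coord.
Unshelve. all: by end_near. Qed.

Definition pair_score {R : realType} {n} (X : 'M[R]_n)
    (eps : 'I_n -> 'I_n -> R -> R -> R) k j (a : 'rV[R]_n) : R :=
  bernoulli_score (X k j) (edge_prob eps k j a) (partial k (eps_at eps k j) a).

Definition score {R : realType} {n} (X : 'M[R]_n)
    (eps : 'I_n -> 'I_n -> R -> R -> R) k (a : 'rV[R]_n) : R :=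
  \sum_(j | j != k) pair_score X eps k j a.

Lemma derive_comp_scalar {R : realType} {V : normedModType R} (g : R -> R)
    (F : V -> R) (a v : V) (dg : R) :
  differentiable F a -> is_derive (F a) (1 : R) g dg ->
  differentiable (g \o F) a /\ 'D_v (g \o F) a = dg * 'D_v F a.
Proof.
move=> dF dgF.
have dG : differentiable g (F a) by apply/derivable1_diffP; exact: ex_derive.
have dGF : differentiable (g \o F) a by exact: differentiable_comp.
split=> //; rewrite !deriveE// diff_comp//=.
rewrite (_ : 'd F a v = 'd F a v *: (1 : R)); last by rewrite [RHS]mulr1.
rewrite linearZ /= -(deriveE (1 : R) dG) (@derive_val _ _ _ _ _ _ _ dgF).
by rewrite [_ *: 1]mulr1 mulrC.
Qed.

(** The chain rule through the log-probability of each pair: it has slope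
    [1 + D] in either of its two coordinates, and is constant in the others. *)
Lemma likelihood_gradient {R : realType} {n} (X : 'M[R]_n)
    (eps : 'I_n -> 'I_n -> R -> R -> R) (a : 'rV[R]_n) :
    (forall i j, X i j = X j i) ->
    (forall i j : 'I_n, i != j -> smooth2 (eps i j)) ->
    (forall (i j : 'I_n) (x y : R), i != j -> eps i j x y = eps j i y x) ->
    loglik_dom eps a ->
  differentiable (loglik X eps) a /\
  forall k, partial k (loglik X eps) a = score X eps k a.
Proof.
move=> Xsym seps eps_sym dom.
pose T i j : 'rV[R]_n -> R := pair_loglik (X i j) \o log_prob eps i j.
pose W (i j : 'I_n) := if (i < j)%N then T i j else cst 0.
have dT i j v : i != j -> differentiable (T i j) a /\ 'D_v (T i j) a =
    bernoulli_score (X i j) (edge_prob eps i j a) 0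
    * 'D_v (log_prob eps i j) a.
  move=> ij; apply: derive_comp_scalar.
    exact: differentiable_log_prob (seps i j ij).
  exact: is_derive_pair_loglik (dom i j ij).
have Tsym i j : i != j -> T i j = T j i.
  move=> ij; apply/funext => b; rewrite /T /= Xsym /log_prob /eps_at.
  by rewrite eps_sym// [b 0 i + _]addrC.
have neq_lt (i j : 'I_n) : (i < j)%N -> i != j by rewrite -val_eqE /=; lia.
have dW i j : differentiable (W i j) a.
  by rewrite /W; case: ifP => // /neq_lt ij; exact: (dT i j 0 ij).1.
have -> : loglik X eps = \sum_i \sum_j W i j.
  apply/funext => b; rewrite /loglik fct_sumE; apply: eq_bigr => i _.
  rewrite fct_sumE big_mkcond; apply: eq_bigr => j _.
  by rewrite /W; case: ifP => // _; rewrite /T /= /pair_loglik /edge_prob expRK.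
have dWi i : differentiable (\sum_j W i j) a by exact: differentiable_sum.
split=> [|k]; first exact: differentiable_sum.
rewrite /partial derive_sum => [|i]; last exact: diff_derivable.
rewrite (eq_bigr (fun i : 'I_n => \sum_(j < n | (i < j)%N) partial k (T i j) a));
  last first.
  move=> i _; rewrite derive_sum => [|j]; last exact: diff_derivable.
  rewrite [RHS]big_mkcond; apply: eq_bigr => j _; rewrite /W.
  by case: ifP => // _; rewrite derive_cst.
rewrite (sum_upper_pairs (fun i j => partial k (T i j) a) k).
- apply: eq_bigr => j jk; have kj : k != j by rewrite eq_sym.
  rewrite /partial (dT k j _ kj).2 /pair_score -/(partial k (log_prob eps k j) a).
  rewrite (partial_log_prob _ _ _ _ _ (seps k j kj)) eqxx (negbTE jk) addr0.
  by rewrite /bernoulli_score addr0 mulr1.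
- by move=> i j ij; rewrite Tsym.
- move=> i j ij ik jk.
  rewrite /partial (dT i j _ ij).2 -/(partial k (log_prob eps i j) a).
  rewrite (partial_log_prob _ _ _ _ _ (seps i j ij)) (negbTE ik) (negbTE jk).
  by rewrite partial_eps_at_eq0// !addr0 mulr0.
Qed.

(** * Estimates for one pair *)

(** Both sides come from [1 + t <= exp t], at [t = v] and at [t = - v]. *)
Lemma expR_sub1_le {R : realType} (v B : R) :
  `|v| <= B -> B < 1 -> `|expR v - 1| <= B / (1 - B).
Proof.
rewrite ler_norml => /andP[vB1 vB2] B1.
have B0 : 0 < 1 - B by rewrite subr_gt0.
have B'0 : 0 <= B by lra.
have := expR_ge1Dx v; have := expR_ge1Dx (- v); rewrite expRN => ev1 ev2.
have ev0 := expR_gt0 v.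
have ev3 : (1 - v) * expR v <= 1.
  by have := ler_wpM2r (ltW ev0) ev1; rewrite mulVf// gt_eqF.
have -> : B / (1 - B) = (1 - B)^-1 - 1 by field; rewrite gt_eqF.
have ev4 : expR v <= (1 - B)^-1.
  by rewrite -[leRHS]mul1r ler_pdivlMr//; nra.
have B2 : 1 + B <= (1 - B)^-1.
  by rewrite -[leRHS]mul1r ler_pdivlMr//; nra.
rewrite ler_norml; apply/andP; split; lra.
Qed.

(** Mean value theorem for [exp t - t], whose derivative is small near 0. *)
Lemma expR_sub_le {R : realType} (u v B : R) : `|u| <= B -> `|v| <= B -> B < 1 ->
  `|expR u - expR v - (u - v)| <= B / (1 - B) * `|u - v|.
Proof.
move=> + + B1; wlog uv : u v / v <= u => [th uB vB|uB vB].
  have [vu|/ltW uv] := leP v u; first exact: th.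
  have := th v u uv vB uB; rewrite [`|v - u|]distrC -[in leLHS]normrN.
  by congr (`|_| <= _); ring.
pose f (x : R) := expR x - x.
have df (x : R) : is_derive x (1 : R) f (expR x - 1).
  by rewrite (_ : f = @expR R - @id R)//; exact: is_deriveB.
have cf A : {within A, continuous f}%classic.
  apply: continuous_subspaceT => s; apply: differentiable_continuous.
  by apply/derivable1_diffP; apply: ex_derive.
have [c] := MVT_segment uv (fun s _ => df s) (cf _).
rewrite in_itv /= => /andP[vc cu] fE.
have -> : expR u - expR v - (u - v) = f u - f v by rewrite /f /=; ring.
rewrite fE normrM ler_wpM2r// expR_sub1_le//.
by move: uB vB; rewrite !ler_norml => /andP[? ?] /andP[? ?]; apply/andP; split; lra.
Qed.

(** The constant 47/500 bounds the displacement of a log-probability on the ball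
    of radius 2/45: 4/45 from the two parameters and 1/200 from the term eps.
    The factor 1104/1000 exceeds 1 / (1 - 47/500). *)
Lemma perturbed_prob_bounds {R : realType} (P v : R) :
  0 < P -> `|v| <= 47 / 500 -> 0 <= P * expR v <= 1104 / 1000 * P.
Proof.
move=> P0 v1; have B1 : (47 / 500 : R) < 1 by clear; lra.
have Bv : (47 / 500 : R) / (1 - 47 / 500) <= 13 / 125.
  by rewrite ler_pdivrMr; clear; lra.
have := le_trans (expR_sub1_le _ _ v1 B1) Bv.
rewrite ler_norml => /andP[e1 e2]; clear - P0 e1 e2.
by apply/andP; split; nra.
Qed.

(** Here [s] is the part of the increment of the log-probability due to the two
    parameters and the remainder, of size [d / 100], is due to eps: to first
    order the probability moves by [P * s]. *)
Lemma perturbed_prob_diff {R : realType} (P va vb s d : R) :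
    0 < P -> 0 <= d -> `|va| <= 47 / 500 -> `|vb| <= 47 / 500 ->
    `|s| <= 2 * d -> `|va - vb - s| <= d / 100 ->
  `|P * expR va - P * expR vb - P * s| <= 22 / 100 * P * d /\
  `|P * expR va - P * expR vb| <= 222 / 100 * P * d.
Proof.
move=> P0 d0 va1 vb1 s1 e1.
have B1 : (47 / 500 : R) < 1 by lra.
have Bv : (47 / 500 : R) / (1 - 47 / 500) <= 13 / 125.
  by rewrite ler_pdivrMr; lra.
have exy := le_trans (expR_sub_le _ _ _ va1 vb1 B1) (ler_wpM2r (normr_ge0 _) Bv).
clear va1 vb1 B1; set ea := expR va in exy *.
set eb := expR vb in exy *; set w := va - vb in e1 exy.
have w1 : `|w| <= 201 / 100 * d.
  by have := ler_normD (w - s) s; rewrite subrK; lra.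
have exy' : `|ea - eb - w| <= 13 / 125 * (201 / 100 * d).
  by clear - exy w1; lra.
clear exy w1 Bv.
have ps : `|P * ea - P * eb - P * s| <= 22 / 100 * P * d.
  have -> : P * ea - P * eb - P * s = P * ((ea - eb - w) + (w - s)) by ring.
  rewrite normrM (gtr0_norm P0) [22 / 100 * P]mulrC -mulrA ler_wpM2l ?(ltW P0)//.
  by have := ler_normD (ea - eb - w) (w - s); lra.
split=> //.
have -> : P * ea - P * eb = (P * ea - P * eb - P * s) + P * s by ring.
have := ler_normD (P * ea - P * eb - P * s) (P * s).
rewrite (normrM P) (gtr0_norm P0); have := ler_wpM2l (ltW P0) s1; lra.
Qed.

(** The factor [(1 + D) / (1 - p)] multiplies the residual [x - p] in
    [bernoulli_score]; it is close to 1. *)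
Lemma weight_sub1_le {R : realType} (p D A : R) : 0 <= p <= 1 / 200 ->
  `|D| + p <= A -> `|(1 + D) / (1 - p) - 1| <= 200 / 199 * A.
Proof.
move=> /andP[p0 p1] DA.
have p2 : 0 < 1 - p by lra.
have -> : (1 + D) / (1 - p) - 1 = (D + p) / (1 - p) by field; rewrite gt_eqF.
rewrite normrM normfV (gtr0_norm p2) ler_pdivrMr//.
have := ler_normD D p; rewrite (ger0_norm p0) => Dp.
have := normr_ge0 (D + p); nra.
Qed.

Lemma weight_diff_le {R : realType} (P pa pb Da Db d : R) :
    0 < P <= 1 / 225 -> 0 <= d -> 0 <= pa <= 1 / 200 -> 0 <= pb <= 1 / 200 ->
    `|Db| <= 1 / 200 ->
    `|pa - pb| <= 222 / 100 * P * d -> `|Da - Db| <= d / 100 ->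
  `|(1 + Da) / (1 - pa) - (1 + Db) / (1 - pb)| <= 202 / 10000 * d.
Proof.
move=> /andP[P0 P1] d0 /andP[pa0 pa1] pb01 Db1 pd D1.
have [pb0 pb1] := andP pb01.
have a1 : 0 < 1 - pa by lra.
have b1 : 0 < 1 - pb by lra.
have DA : `|Db| + pb <= 1 / 100 by lra.
have Wb1 := weight_sub1_le _ _ _ pb01 DA.
set Wb := (1 + Db) / (1 - pb) in Wb1 *.
have -> : (1 + Da) / (1 - pa) - Wb = ((Da - Db) + Wb * (pa - pb)) / (1 - pa).
  by rewrite /Wb; field; rewrite !gt_eqF.
rewrite normrM normfV (gtr0_norm a1) ler_pdivrMr//.
apply: le_trans (ler_normD _ _) _; rewrite normrM.
have Wb2 : `|Wb| <= 102 / 100.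
  by have := ler_normD (Wb - 1) 1; rewrite subrK normr1; lra.
have Wp : `|Wb| * `|pa - pb| <= 102 / 100 * (222 / 100 * P * d).
  by rewrite ler_pM.
have := ler_wpM2r d0 P1; have := ler_wpM2r d0 pa1; clear - Wp D1 d0; lra.
Qed.

(** The increment of [bernoulli_score] is close to [- P * s].  The error splits
    into the nonlinearity of the probability, the deviation of the weight
    [(1 + D) / (1 - p)] from 1, and the increment of that weight, which is
    multiplied by the residual [x - p]: this last term is why [x] appears in the
    bound besides [P]. *)
Lemma bernoulli_score_contraction {R : realType} (x P va vb Da Db s d : R) :
    0 <= x -> 0 < P <= 1 / 225 -> 0 <= d ->
    `|va| <= 47 / 500 -> `|vb| <= 47 / 500 ->
    `|Da| <= 1 / 200 -> `|Db| <= 1 / 200 ->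
    `|s| <= 2 * d -> `|va - vb - s| <= d / 100 -> `|Da - Db| <= d / 100 ->
  `|bernoulli_score x (P * expR va) Da - bernoulli_score x (P * expR vb) Db + P * s|
    <= (27 / 100 * P + 21 / 1000 * x) * d.
Proof.
move=> x0 /andP[P0 P1] d0 va1 vb1 Da1 Db1 s1 e1 D1.
have P01 : 0 < P <= 1 / 225 by rewrite P0.
have := perturbed_prob_bounds _ _ P0 vb1; have := perturbed_prob_bounds _ _ P0 va1.
have [] := perturbed_prob_diff P va vb s d P0 d0 va1 vb1 s1 e1.
rewrite /bernoulli_score; set pa := P * expR va; set pb := P * expR vb.
move=> ps pd pa02 pb01; clear va1 vb1 s1 e1.
have pa01 : 0 <= pa <= 1 / 200 by clear - pa02 P1; lra.
have pb01' : 0 <= pb <= 1 / 200 by clear - pb01 P1; lra.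
have a1 : 0 < 1 - pa by clear - pa01; lra.
have b1 : 0 < 1 - pb by clear - pb01'; lra.
have Wab := weight_diff_le P pa pb Da Db d P01 d0 pa01 pb01' Db1 pd D1.
have DA : `|Da| + pa <= 1 / 100 by clear - Da1 pa01; lra.
have Wa1 := weight_sub1_le _ _ _ pa01 DA.
have Pd := mulr_ge0 (ltW P0) d0; have xd := mulr_ge0 x0 d0.
set Wa := (1 + Da) / (1 - pa) in Wa1 Wab *; set Wb := (1 + Db) / (1 - pb) in Wab *.
have -> : (x - pa) / (1 - pa) * (1 + Da) - (x - pb) / (1 - pb) * (1 + Db) + P * s =
  - (pa - pb - P * s) - (pa - pb) * (Wa - 1) + (x - pb) * (Wa - Wb).
  by rewrite /Wa /Wb; field; rewrite !gt_eqF.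
have t1 : `|(pa - pb) * (Wa - 1)| <= 225 / 10000 * P * d.
  have Wp : `|pa - pb| * `|Wa - 1| <= 222 / 100 * P * d * (200 / 199 * (1 / 100)).
    by rewrite ler_pM.
  by rewrite normrM; clear - Pd Wp; lra.
have t2 : `|(x - pb) * (Wa - Wb)| <= (x + 1104 / 1000 * P) * (202 / 10000 * d).
  have [pb0 pb2] := andP pb01.
  rewrite normrM ler_pM//; apply: le_trans (ler_normB _ _) _.
  by rewrite (ger0_norm x0) (ger0_norm pb0) lerD2l.
have := ler_normD (- (pa - pb - P * s) - (pa - pb) * (Wa - 1)) ((x - pb) * (Wa - Wb)).
have := ler_normB (- (pa - pb - P * s)) ((pa - pb) * (Wa - 1)); rewrite normrN.
clear - Pd xd ps t1 t2; lra.
Qed.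

(** At the centre of the ball the score is, up to a relative error of order
    [(C0 + 1) * e0], the residual [x - P] of the model without eps. *)
Lemma bernoulli_score_base {R : realType} (x P v D C0 e0 : R) :
    0 <= x -> 0 < P <= e0 -> 0 <= C0 -> (C0 + 1) * e0 <= 1 / 225 ->
    `|v| <= C0 * P -> `|D| <= C0 * P ->
  `|bernoulli_score x (P * expR v) D - (x - P)|
    <= e0 * ((101 / 100 * C0 + 103 / 100 * (C0 + 1)) * P
             + 102 / 100 * (C0 + 1) * x).
Proof.
move=> x0 /andP[P0 Pe] C0_ge0 Ke vB DB.
have e0_gt0 : 0 < e0 := lt_le_trans P0 Pe.
have CP : C0 * P <= C0 * e0 by rewrite ler_wpM2l.
have Ce_ge0 : 0 <= C0 * e0 by rewrite mulr_ge0// ltW.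
have Ce : C0 * e0 <= 1 / 225 by clear - Ke e0_gt0; lra.
have ev : `|expR v - 1| <= 101 / 100 * (C0 * e0).
  have B1 : C0 * e0 < 1 by clear - Ce; lra.
  apply: le_trans (expR_sub1_le _ _ (le_trans vB CP) B1) _.
  rewrite ler_pdivrMr; last by rewrite subr_gt0.
  by clear - Ce Ce_ge0; nra.
set p := P * expR v.
have pP : `|p - P| <= P * (101 / 100 * (C0 * e0)).
  have -> : p - P = P * (expR v - 1) by rewrite /p; ring.
  by rewrite normrM (gtr0_norm P0) ler_wpM2l// ltW.
have p0 : 0 <= p by rewrite mulr_ge0// ?expR_ge0// ltW.
have p1 : p <= 1005 / 1000 * P.
  move: pP; rewrite ler_norml => /andP[_ pP].
  by have := ler_wpM2l (ltW P0) Ce; clear - pP P0; lra.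
clearbody p; clear ev vB.
have p01 : 0 <= p <= 1 / 200.
  by rewrite p0; clear - p1 Pe Ke Ce_ge0 e0_gt0; lra.
have DA : `|D| + p <= 1005 / 1000 * ((C0 + 1) * e0).
  by clear - DB p1 CP Pe Ce_ge0 e0_gt0; lra.
have W1 := weight_sub1_le _ _ _ p01 DA.
have q1 : 0 < 1 - p by clear - p01; lra.
rewrite /bernoulli_score.
have -> : (x - p) / (1 - p) * (1 + D) - (x - P) =
    (x - p) * ((1 + D) / (1 - p) - 1) - (p - P) by field; rewrite gt_eqF.
apply: le_trans (ler_normB _ _) _; rewrite normrM.
have xp : `|x - p| <= x + 1005 / 1000 * P.
  apply: le_trans (ler_normB _ _) _.
  by rewrite (ger0_norm x0) (ger0_norm p0) lerD2l.
have := ler_pM (normr_ge0 _) (normr_ge0 _) xp W1.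
have K0 : 0 <= (C0 + 1) * e0 by clear - Ce_ge0 e0_gt0; lra.
have := mulr_ge0 x0 K0; have := mulr_ge0 (ltW P0) K0.
clear - pP; lra.
Qed.

(** * The Newton step *)

Lemma sum_gt0 {R : realType} {n} (d : 'I_n -> R) (k : 'I_n) :
  (forall i, 0 < d i) -> 0 < \sum_i d i.
Proof.
move=> d0; rewrite (bigD1 k)//= ltr_wpDr// sumr_ge0// => i _; exact: ltW.
Qed.

(** The norm of [1 - 1 d^T / (2 S)] as an operator for the maximum norm, where
    [S] is the sum of [d], is at most [3 / 2]. *)
Lemma newton_step_le {R : realType} {n} (d h : 'I_n -> R) (c : R) (k : 'I_n) :
    (forall i, 0 < d i) -> (forall i, `|h i| <= c * d i) ->
  `|h k / d k - (\sum_i h i) / (2 * \sum_i d i)| <= 3 / 2 * c.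
Proof.
move=> d0 hc.
have S0 : 0 < \sum_i d i by exact: sum_gt0.
have hk : `|h k / d k| <= c.
  by rewrite normrM normfV (gtr0_norm (d0 k)) ler_pdivrMr.
have hS : `|(\sum_i h i) / (2 * \sum_i d i)| <= c / 2.
  have S20 : 0 < 2 * \sum_i d i by rewrite mulr_gt0.
  rewrite normrM normfV (gtr0_norm S20) ler_pdivrMr//.
  apply: le_trans (ler_norm_sum _ _ _) _.
  have -> : c / 2 * (2 * \sum_i d i) = \sum_i c * d i by rewrite -mulr_sumr; field.
  exact: ler_sum.
by apply: le_trans (ler_normB _ _) _; clear - hk hS; lra.
Qed.

(** Here [f] and [dl] are the increments of the score and of the parameter.  Let
    [m] be the [d]-weighted mean of [dl].  Up to the diagonal terms of size
    [d_i ^ 2 / S <= e0 * d_i], the linear model of the score is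
    [- d_i * (dl_i + m)]; dividing by [d_i] leaves [- dl_i - m], and the rank-one
    correction adds [m] back, so that the step cancels [dl] and only the error
    [h] remains. *)
Lemma newton_step_contraction {R : realType} {n} (d f dl : 'I_n -> R)
    (S c e0 D : R) (k : 'I_n) :
    S = \sum_i d i -> (forall i, 0 < d i) -> (forall i, d i <= e0 * S) ->
    0 <= D -> (forall i, `|dl i| <= D) ->
    (forall i, `|f i + \sum_(j | j != i) d i * d j / S * (dl i + dl j)|
                 <= c * d i * D) ->
  `|dl k + f k / d k - (\sum_i f i) / (2 * S)| <= 3 / 2 * (c + 2 * e0) * D.
Proof.
move=> SE d0 dS D0 dlD fD.
have S0 : 0 < S by rewrite SE; exact: sum_gt0.
pose m := (\sum_i d i * dl i) / S.
pose h i := f i + d i * (dl i + m).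
have mS : \sum_i d i * dl i = S * m by rewrite /m mulrC divfK// gt_eqF.
have hD i : `|h i| <= (c + 2 * e0) * D * d i.
  have E : \sum_(j | j != i) d i * d j / S * (dl i + dl j) =
      d i * (dl i + m) - 2 * (d i / S * d i * dl i).
    rewrite -[LHS](addrK (d i * d i / S * (dl i + dl i))).
    have -> : \sum_(j | j != i) d i * d j / S * (dl i + dl j) +
        d i * d i / S * (dl i + dl i) = \sum_j d i / S * (d j * dl i + d j * dl j).
      rewrite [RHS](bigD1 i)//= addrC; congr (_ + _); last by ring.
      by apply: eq_bigr => j _; ring.
    rewrite -mulr_sumr big_split/= mS -mulr_suml -SE.
    by field; rewrite gt_eqF.
  have -> : h i = (f i + \sum_(j | j != i) d i * d j / S * (dl i + dl j))
      + 2 * (d i / S * d i * dl i) by rewrite E /h; ring.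
  apply: le_trans (ler_normD _ _) _.
  have : `|d i / S * d i * dl i| <= e0 * d i * D.
    rewrite normrM ler_pM// normrM (gtr0_norm (d0 i)) ler_wpM2r ?(ltW (d0 i))//.
    by rewrite gtr0_norm ?divr_gt0// ler_pdivrMr.
  by have := fD i; rewrite (normrM 2) (ger0_norm (ler0n R 2)); clear; lra.
have sumh : \sum_i h i = \sum_i f i + 2 * S * m.
  rewrite big_split/=; congr (_ + _).
  under eq_bigr do rewrite mulrDr.
  by rewrite big_split/= mS -mulr_suml -SE; ring.
have -> : dl k + f k / d k - (\sum_i f i) / (2 * S) =
    h k / d k - (\sum_i h i) / (2 * \sum_i d i).
  by rewrite -SE sumh /h; field; rewrite !gt_eqF.
by have := newton_step_le _ _ _ k d0 hD; clear; lra.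
Qed.

(** * The score near the centre *)

Lemma edge_prob_shift {R : realType} {n} (eps : 'I_n -> 'I_n -> R -> R -> R)
    i j (z a : 'rV[R]_n) :
  edge_prob eps i j a = expR (z 0 i + z 0 j)
    * expR ((a - z) 0 i + (a - z) 0 j + eps_at eps i j a).
Proof. by rewrite -expRD /edge_prob; congr expR; rewrite !mxE; ring. Qed.

(** On the ball, [a_i + a_j] exceeds [z_i + z_j] by at most [4 / 45], which
    multiplies the exponential bounds by at most [45 / 41], and [45 / 41 / 225] is
    less than [1 / 200]. *)
Lemma sub_exponential_near {R : realType} {n} (eps : 'I_n -> 'I_n -> R -> R -> R)
    (C0 : R) i j (z a : 'rV[R]_n) :
    0 <= C0 -> i != j -> sub_exponential C0 eps ->
    C0 * expR (z 0 i + z 0 j) <= 1 / 225 -> `|a - z| <= 2 / 45 ->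
  [/\ a 0 i + a 0 j <= z 0 i + z 0 j + 4 / 45,
      C0 * expR (z 0 i + z 0 j + 4 / 45) <= 1 / 200,
      `|eps_at eps i j a| <= 1 / 200,
      `|partial i (eps_at eps i j) a| <= 1 / 200 &
      `|(a - z) 0 i + (a - z) 0 j + eps_at eps i j a| <= 47 / 500].
Proof.
move=> C00 ij subeps CP az.
have azi := le_trans (ler_coord_norm (a - z) i) az.
have azj := le_trans (ler_coord_norm (a - z) j) az.
have aM : a 0 i + a 0 j <= z 0 i + z 0 j + 4 / 45.
  move: azi azj; rewrite !mxE !ler_norml => /andP[_ di] /andP[_ dj].
  by clear - di dj; lra.
have CM : C0 * expR (z 0 i + z 0 j + 4 / 45) <= 1 / 200.
  rewrite expRD mulrA.
  have e1 : expR (4 / 45 : R) <= 45 / 41.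
    have : `|expR (4 / 45 : R) - 1| <= (4 / 45) / (1 - 4 / 45).
      apply: expR_sub1_le; last by clear; lra.
      by rewrite ger0_norm//; clear; lra.
    have -> : (4 / 45 : R) / (1 - 4 / 45) = 4 / 41 by clear; field.
    by rewrite ler_norml => /andP[_ h]; clear - h; lra.
  have CP0 : 0 <= C0 * expR (z 0 i + z 0 j) by rewrite mulr_ge0// expR_ge0.
  have := ler_pM CP0 (expR_ge0 _) CP e1; clear; lra.
have CaM : C0 * expR (a 0 i + a 0 j) <= 1 / 200.
  by apply: le_trans CM; rewrite ler_wpM2l// ler_expR.
have [E D _ _] := subeps i j ij i i i a.
have E1 := le_trans E CaM; have D1 := le_trans D CaM.
split=> //; apply: le_trans (ler_normD _ _) _.
have := ler_normD ((a - z) 0 i) ((a - z) 0 j).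
by clear - E1 azi azj; lra.
Qed.

Lemma edge_prob_near_lt1 {R : realType} {n} (eps : 'I_n -> 'I_n -> R -> R -> R)
    (C0 : R) i j (z a : 'rV[R]_n) :
    0 <= C0 -> i != j -> sub_exponential C0 eps ->
    (C0 + 1) * expR (z 0 i + z 0 j) <= 1 / 225 -> `|a - z| <= 2 / 45 ->
  edge_prob eps i j a < 1.
Proof.
move=> C00 ij subeps; rewrite mulrDl mul1r => KP az.
have P0 := expR_gt0 (z 0 i + z 0 j).
have CP0 : 0 <= C0 * expR (z 0 i + z 0 j) by rewrite mulr_ge0// ltW.
have CP : C0 * expR (z 0 i + z 0 j) <= 1 / 225 by clear - KP P0; lra.
have P01 : 0 < expR (z 0 i + z 0 j) <= 1 / 225.
  by rewrite P0; clear - KP CP0; lra.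
have [_ _ _ _ v] := sub_exponential_near _ _ _ _ _ _ C00 ij subeps CP az.
have := perturbed_prob_bounds _ _ P0 v; rewrite -edge_prob_shift.
by move=> /andP[_]; move: P01 => /andP[_]; clear; lra.
Qed.

Lemma pair_score_contraction {R : realType} {n} (X : 'M[R]_n)
    (eps : 'I_n -> 'I_n -> R -> R -> R) (C0 : R) k j (z a b : 'rV[R]_n)
    (P := expR (z 0 k + z 0 j)) :
    0 <= X k j -> 0 <= C0 -> k != j ->
    smooth2 (eps k j) -> sub_exponential C0 eps ->
    (C0 + 1) * P <= 1 / 225 -> `|a - z| <= 2 / 45 -> `|b - z| <= 2 / 45 ->
  `|pair_score X eps k j a - pair_score X eps k j b
      + P * ((a - b) 0 k + (a - b) 0 j)|
    <= (27 / 100 * P + 21 / 1000 * X k j) * `|a - b|.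
Proof.
move=> X0 C00 kj seps subeps; rewrite mulrDl mul1r => KP az bz.
have P0 : 0 < P := expR_gt0 _.
have CP0 : 0 <= C0 * P by rewrite mulr_ge0// ltW.
have CP : C0 * P <= 1 / 225 by clear - KP P0; lra.
have P01 : 0 < P <= 1 / 225 by rewrite P0; clear - KP CP0; lra.
have [aM CM _ Da va] := sub_exponential_near _ _ _ _ _ _ C00 kj subeps CP az.
have [bM _ _ Db vb] := sub_exponential_near _ _ _ _ _ _ C00 kj subeps CP bz.
have dk := ler_coord_norm (a - b) k; have dj := ler_coord_norm (a - b) j.
have dk' : `|a 0 k - b 0 k| <= `|a - b| by move: dk; rewrite !mxE.
have dj' : `|a 0 j - b 0 j| <= `|a - b| by move: dj; rewrite !mxE.
have [Elip Dlip] :=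
  eps_lipschitz eps C0 k j _ _ a b C00 kj seps subeps aM bM dk' dj'.
have CMd := ler_wpM2r (normr_ge0 (a - b)) CM.
have lip (t : R) : `|t| <= 2 * (C0 * expR (z 0 k + z 0 j + 4 / 45)) * `|a - b| ->
    `|t| <= `|a - b| / 100 by clear - CMd; lra.
rewrite /pair_score !(edge_prob_shift eps k j z).
apply: bernoulli_score_contraction => //.
- by have := ler_normD ((a - b) 0 k) ((a - b) 0 j); clear - dk dj; lra.
- rewrite (_ : _ - _ = eps_at eps k j a - eps_at eps k j b); last first.
    by rewrite !mxE; ring.
  exact: lip.
- exact: lip.
Qed.

Lemma pair_score_base {R : realType} {n} (X : 'M[R]_n)
    (eps : 'I_n -> 'I_n -> R -> R -> R) (C0 e0 : R) k j (z : 'rV[R]_n)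
    (P := expR (z 0 k + z 0 j)) :
    0 <= X k j -> 0 <= C0 -> k != j -> sub_exponential C0 eps ->
    P <= e0 -> (C0 + 1) * e0 <= 1 / 225 ->
  `|pair_score X eps k j z - (X k j - P)|
    <= e0 * ((101 / 100 * C0 + 103 / 100 * (C0 + 1)) * P
             + 102 / 100 * (C0 + 1) * X k j).
Proof.
move=> X0 C00 kj subeps Pe Ke.
have [E D _ _] := subeps k j kj k k k z.
have -> : pair_score X eps k j z = bernoulli_score (X k j)
    (P * expR (eps_at eps k j z)) (partial k (eps_at eps k j) z).
  by rewrite /pair_score /edge_prob expRD.
by apply: bernoulli_score_base => //; rewrite expR_gt0.
Qed.

Lemma degreeE {R : realType} {n} (X : 'M[R]_n) k :
  X k k = 0 -> degree X k = \sum_(j | j != k) X k j.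
Proof. by move=> Xk; rewrite /degree (bigD1 k)//= Xk add0r. Qed.

Lemma sum_expected {R : realType} {n} (X : 'M[R]_n) k :
    (forall i, 0 < degree X i) ->
  \sum_(j | j != k) degree X k * degree X j / total_degree X =
    degree X k - degree X k * degree X k / total_degree X.
Proof.
move=> d0; set S := total_degree X.
have S0 : 0 < S by exact: sum_gt0.
have {2}-> : degree X k = \sum_j degree X k * degree X j / S.
  by rewrite -mulr_suml -mulr_sumr -/(total_degree X) -/S mulfK// gt_eqF.
by rewrite [X in _ = X - _](bigD1 k)//= addrAC subrr add0r.
Qed.

(** * Existence of a solution near the explicit approximation *)

Definition newton_map {R : realType} {n} (X : 'M[R]_n)
    (eps : 'I_n -> 'I_n -> R -> R -> R) (a : 'rV[R]_n) : 'rV[R]_n :=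
  \row_k (a 0 k + score X eps k a / degree X k
          - (\sum_l score X eps l a) / (2 * total_degree X)).

(** A fixed point has scores [c * d_k] with the constant
    [c = (sum_l f_l) / (2 S)]; summing over [k] gives [c = c / 2]. *)
Lemma newton_map_fixed {R : realType} {n} (X : 'M[R]_n)
    (eps : 'I_n -> 'I_n -> R -> R -> R) (a : 'rV[R]_n) :
    (forall i, 0 < degree X i) -> newton_map X eps a = a ->
  forall k, score X eps k a = 0.
Proof.
move=> d0 fixa k.
have S0 : 0 < total_degree X by exact: sum_gt0.
pose c := (\sum_l score X eps l a) / (2 * total_degree X).
have scE i : score X eps i a = c * degree X i.
  move/rowP: fixa => /(_ i); rewrite mxE -/c => fixi.
  apply: (canRL (divfK _)); first by rewrite gt_eqF.
  by clear - fixi; lra.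
have cE : c = c / 2.
  rewrite {1}/c; under eq_bigr do rewrite scE.
  rewrite -mulr_sumr -/(total_degree X); field; by rewrite gt_eqF.
by rewrite scE (_ : c = 0) ?mul0r//; clear - cE; lra.
Qed.

(** In each row the errors of the pairs add up to at most
    [(27 / 100 + 21 / 1000) * d_i], and
    [3 / 2 * (291 / 1000 + 2 / 225) <= 45 / 100]. *)
Lemma newton_map_contraction {R : realType} {n} (X : 'M[R]_n)
    (eps : 'I_n -> 'I_n -> R -> R -> R) (C0 e0 : R) (z a b : 'rV[R]_n) :
    (forall i j, 0 <= X i j) -> (forall i, X i i = 0) ->
    (forall i, 0 < degree X i) -> 0 <= C0 ->
    (forall i j : 'I_n, i != j -> smooth2 (eps i j)) ->
    sub_exponential C0 eps ->
    (forall i j, expR (z 0 i + z 0 j) = degree X i * degree X j / total_degree X) ->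
    (forall i j, expR (z 0 i + z 0 j) <= e0) ->
    (forall i, degree X i <= e0 * total_degree X) ->
    (C0 + 1) * e0 <= 1 / 225 ->
    `|a - z| <= 2 / 45 -> `|b - z| <= 2 / 45 ->
  `|newton_map X eps a - newton_map X eps b| <= 45 / 100 * `|a - b|.
Proof.
move=> X0 Xd d0 C00 seps subeps zE ze0 dS Ke az bz.
have K0 : 0 <= C0 + 1 by rewrite addr_ge0.
have e0_le : e0 <= 1 / 225 - C0 * e0 by clear - Ke; lra.
apply: norm_le_coord => [|k]; first by rewrite mulr_ge0// divr_ge0.
have e0_ge0 : 0 <= e0 := le_trans (expR_ge0 _) (ze0 k k).
have e0_le2 : e0 <= 1 / 225 by have := mulr_ge0 C00 e0_ge0; clear - e0_le; lra.
pose f i := score X eps i a - score X eps i b.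
have fD i : `|f i + \sum_(j | j != i) degree X i * degree X j / total_degree X
      * ((a - b) 0 i + (a - b) 0 j)| <= 291 / 1000 * degree X i * `|a - b|.
  rewrite /f /score -sumrB -big_split /=.
  apply: le_trans (ler_norm_sum _ _ _) _.
  apply: (@le_trans _ _ (\sum_(j | j != i) (27 / 100 *
     (degree X i * degree X j / total_degree X) + 21 / 1000 * X i j) * `|a - b|)).
    apply: ler_sum => j ji; have ij : i != j by rewrite eq_sym.
    rewrite -zE; apply: (pair_score_contraction X eps C0) => //; first exact: seps.
    by apply: le_trans Ke; rewrite ler_wpM2l.
  rewrite -mulr_suml ler_wpM2r// big_split /= -!mulr_sumr.
  rewrite -degreeE// sum_expected//.
  have di := ltW (d0 i); have Pi : 0 <= degree X i * degree X i / total_degree X.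
    by rewrite divr_ge0 ?mulr_ge0// ltW// sum_gt0.
  by clear - Pi; lra.
have dlD i : `|(a - b) 0 i| <= `|a - b| := ler_coord_norm _ i.
have := newton_step_contraction (degree X) f (fun i => (a - b) 0 i)
  (total_degree X) (291 / 1000) e0 `|a - b| k erefl d0 dS (normr_ge0 _) dlD fD.
rewrite (_ : _ + _ - _ = (newton_map X eps a - newton_map X eps b) 0 k); last first.
  by rewrite !mxE /f sumrB; ring.
move=> /le_trans; apply; rewrite ler_wpM2r//.
by clear - e0_le2; lra.
Qed.

(** The residuals [X_ij - P_ij] of row [i] add up to [d_i ^ 2 / S], which is the
    missing diagonal term and at most [e0 * d_i]; the other errors are those of
    [bernoulli_score_base].  Together they are at most
    [31 / 10 * (C0 + 1) * e0 * d_i], because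
    [101/100 * C0 + 205/100 * (C0 + 1) + 1 <= 306/100 * (C0 + 1)]. *)
Lemma newton_map_base {R : realType} {n} (X : 'M[R]_n)
    (eps : 'I_n -> 'I_n -> R -> R -> R) (C0 e0 : R) (z : 'rV[R]_n) :
    (forall i j, 0 <= X i j) -> (forall i, X i i = 0) ->
    (forall i, 0 < degree X i) -> 0 <= C0 ->
    sub_exponential C0 eps ->
    (forall i j, expR (z 0 i + z 0 j) = degree X i * degree X j / total_degree X) ->
    (forall i j, expR (z 0 i + z 0 j) <= e0) ->
    (forall i, degree X i <= e0 * total_degree X) ->
    0 <= e0 -> (C0 + 1) * e0 <= 1 / 225 ->
  `|newton_map X eps z - z| <= 465 / 100 * ((C0 + 1) * e0).
Proof.
move=> X0 Xd d0 C00 subeps zE ze0 dS e0_ge0 Ke.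
have K0 : 0 <= C0 + 1 by rewrite addr_ge0.
have Ke0 : 0 <= (C0 + 1) * e0 by rewrite mulr_ge0.
apply: norm_le_coord => [|k]; first by clear - Ke0; lra.
have fD i : `|score X eps i z| <= 31 / 10 * ((C0 + 1) * e0) * degree X i.
  have S0 : 0 < total_degree X by exact: sum_gt0.
  pose P j := degree X i * degree X j / total_degree X.
  have Xsum : \sum_(j | j != i) X i j = degree X i by rewrite -degreeE.
  have Psum : \sum_(j | j != i) P j = degree X i - P i by exact: sum_expected.
  have Pi : 0 <= P i <= e0 * degree X i.
    have di0 := ltW (d0 i).
    rewrite /P divr_ge0 ?mulr_ge0 ?(ltW S0)//= [leLHS]mulrAC.
    by rewrite ler_wpM2r// ler_pdivrMr.
  have -> : score X eps i z = P i + \sum_(j | j != i)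
      (pair_score X eps i j z - (X i j - P j)).
    by rewrite !sumrB Xsum Psum /score; ring.
  apply: le_trans (ler_normD _ _) _; rewrite (ger0_norm (proj1 (andP Pi))).
  have : `|\sum_(j | j != i) (pair_score X eps i j z - (X i j - P j))| <=
     \sum_(j | j != i) e0 * ((101 / 100 * C0 + 103 / 100 * (C0 + 1)) * P j
             + 102 / 100 * (C0 + 1) * X i j).
    apply: le_trans (ler_norm_sum _ _ _) _; apply: ler_sum => j ji.
    have ij : i != j by rewrite eq_sym.
    by rewrite /P -zE; apply: pair_score_base.
  rewrite [X in _ <= X -> _](_ : _ =
      e0 * ((101 / 100 * C0 + 103 / 100 * (C0 + 1)) * \sum_(j | j != i) P j
            + 102 / 100 * (C0 + 1) * degree X i)); last first.
    by rewrite -mulr_sumr big_split /= -!mulr_sumr Xsum.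
  have Q0 : 0 <= e0 * (101 / 100 * C0 + 103 / 100 * (C0 + 1)).
    by rewrite mulr_ge0//; move: C00; clear; lra.
  have sumP : \sum_(j | j != i) P j <= degree X i.
    by rewrite Psum; move: Pi => /andP[+ _]; clear; lra.
  have := ler_wpM2l Q0 sumP; move: Pi => /andP[_].
  have := mulr_ge0 Ke0 (ltW (d0 i)); have := mulr_ge0 e0_ge0 (ltW (d0 i)).
  by clear; lra.
have := newton_step_le _ _ _ k d0 fD.
rewrite (_ : _ - _ = (newton_map X eps z - z) 0 k); last first.
  by rewrite !mxE /total_degree; ring.
by move=> /le_trans; apply; clear; lra.
Qed.

(** The approximation is the parameter for which the expected number of edges
    between [i] and [j], without the term eps, is [d_i * d_j / S]. *)
Lemma expR_alpha_tilde {R : realType} {n} (X : 'M[R]_n) i j :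
    (forall i, 0 < degree X i) ->
  expR (alpha_tilde X 0 i + alpha_tilde X 0 j) =
    degree X i * degree X j / total_degree X.
Proof.
move=> d0.
have S0 : 0 < total_degree X by exact: sum_gt0.
have sS : 0 < Num.sqrt (total_degree X) by rewrite sqrtr_gt0.
rewrite !mxE expRD !expRB !lnK ?posrE//.
rewrite mulf_div -expr2 sqr_sqrtr//; exact: ltW.
Qed.

Theorem theorem1 (R : realType) (n : nat) (hn : (2 <= n)%N)
  (X : 'M[R]_n) (hX : adjacency X) (eps0 : R)
  (hdeg : forall i : 'I_n,
     1 <= degree X i ^+ 2 /\ degree X i ^+ 2 <= eps0 * total_degree X)
  (C0 : R) (hC0 : 0 <= C0)
  (eps : 'I_n -> 'I_n -> R -> R -> R)
  (eps_smooth : forall i j : 'I_n, i != j -> smooth2 (eps i j))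
  (eps_sym : forall (i j : 'I_n) (x y : R), i != j -> eps i j x y = eps j i y x)
  (eps_subexp : sub_exponential C0 eps) :
  let eps0_bar : R := (15 * (C0 + 1)) ^- 2 in
  let C : R := 10 * (C0 + 1) in
  eps0 <= eps0_bar ->
  exists alpha_hat : 'rV[R]_n,
    likelihood_eq X eps alpha_hat /\
    `|alpha_hat - alpha_tilde X| <= C * eps0.
Proof.
move=> eps0_bar C eps0_le; have [X01 Xsym Xd] := hX.
have X0 i j : 0 <= X i j by case: (X01 i j) => ->.
have d_ge1 i : 1 <= degree X i.
  rewrite -(@ler_pXn2r _ 2)// ?nnegrE ?ler01// ?expr1n; first exact: (hdeg i).1.
  by apply: sumr_ge0 => j _.
have d0 i : 0 < degree X i := lt_le_trans ltr01 (d_ge1 i).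
have i0 : 'I_n by exact: Ordinal hn.
have S0 : 0 < total_degree X by exact: sum_gt0.
have e0_gt0 : 0 < eps0.
  have [h1 h2] := hdeg i0.
  by rewrite -(pmulr_lgt0 _ S0); exact: lt_le_trans ltr01 (le_trans h1 h2).
have K1 : 1 <= C0 + 1 by rewrite lerDr.
have K0 : 0 < C0 + 1 := lt_le_trans ltr01 K1.
have Ke : (C0 + 1) * eps0 <= 1 / 225.
  have sq : eps0 * (15 * (C0 + 1)) ^+ 2 <= 1.
    by rewrite -ler_pdivlMr ?exprn_gt0 ?mulr_gt0// div1r.
  have : 0 <= (C0 + 1) * eps0 * C0 by rewrite !mulr_ge0// ltW.
  by move: sq; clear; lra.
have dS i : degree X i <= eps0 * total_degree X.
  apply: le_trans (hdeg i).2; rewrite expr2.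
  by rewrite ler_peMr// ltW.
pose z := alpha_tilde X.
have zE i j : expR (z 0 i + z 0 j) = degree X i * degree X j / total_degree X.
  exact: expR_alpha_tilde.
have ze0 i j : expR (z 0 i + z 0 j) <= eps0.
  rewrite zE ler_pdivrMr//.
  have := (hdeg i).2; have := (hdeg j).2.
  by have := sqr_ge0 (degree X i - degree X j); clear; lra.
have r_le : C * eps0 <= 2 / 45 by rewrite /C; move: Ke; clear; lra.
have r0 : 0 <= C * eps0 by rewrite /C !mulr_ge0// ltW.
have q01 : 0 <= (45 / 100 : R) < 1 by clear; lra.
have Tlip a b : `|a - z| <= C * eps0 -> `|b - z| <= C * eps0 ->
    `|newton_map X eps a - newton_map X eps b| <= 45 / 100 * `|a - b|.
  move=> /le_trans/(_ r_le) az /le_trans/(_ r_le) bz.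
  exact: (newton_map_contraction X eps C0 eps0 z).
have Tz : `|newton_map X eps z - z| <= (1 - 45 / 100) * (C * eps0).
  have := newton_map_base X eps C0 eps0 z X0 Xd d0 hC0 eps_subexp zE ze0 dS
    (ltW e0_gt0) Ke.
  by rewrite /C; move: (mulr_gt0 K0 e0_gt0); clear; lra.
have [a az Ta] := fixed_point_in_ball (newton_map X eps) z _ _ q01 r0 Tlip Tz.
exists a; split=> //.
have dom : loglik_dom eps a.
  move=> i j ij; apply: (edge_prob_near_lt1 eps C0 i j z) => //.
    by apply: le_trans Ke; rewrite ler_wpM2l// ltW.
  exact: le_trans az r_le.
have [dl gl] := likelihood_gradient X eps a Xsym eps_smooth eps_sym dom.
split=> //; apply/rowP => k; rewrite !mxE gl.
exact: newton_map_fixed Ta k.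
Qed.
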